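(* Let $\Gamma_{\mathbb{Q}}=\bigwedge_{i=1}^{k_1}(x^{a_i}\in\mathbb{Q})\wedge\bigwedge_{j=1}^{k_2}(x^{b_j}\notin\mathbb{Q})$ be a system of rationality constraints (with all $a_i,b_j$ positive integers), and let $c\subseteq\mathbb{R}$ be a 1-cell. Then there exists a real number $r\in c$ with $r^{a_i}\in\mathbb{Q}$ for all $i$ and $r^{b_j}\notin\mathbb{Q}$ for all $j$ if and only if there exists a positive integer $d$ with $d\mid a_i$ for all $i$ and $d\nmid b_j$ for all $j$.
   Context: A real algebraic number is a real root of a nonzero polynomial in $\mathbb{Z}[x]$. A 1-cell is a subset of $\mathbb{R}$ of one of the following forms, where $\alpha,\beta$ are real algebraic numbers: $(-\infty,\alpha)$ with $\alpha\le 0$; $(\alpha,\beta)$ with $0\le\alpha<\beta$ or $\alpha<\beta\le 0$; $(\alpha,+\infty)$ with $\alpha\ge 0$. *)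

(* Defs.v *)
From mathcomp Require Export all_boot all_order all_algebra.
From mathcomp Require Export boolp classical_sets set_interval reals.

Set Implicit Arguments.
Unset Strict Implicit.
Unset Printing Implicit Defensive.
Import Order.TTheory GRing.Theory Num.Theory.

Local Open Scope classical_set_scope.
Local Open Scope ring_scope.

Definition real_algebraic (R : realType) (x : R) : Prop :=
  exists2 p : {poly int}, p != 0 & root (map_poly intr p) x.

Variant one_cell (R : realType) : set R -> Prop :=
| OneCellNinfty (alpha : R) of real_algebraic alpha & alpha <= 0 :
    one_cell `]-oo, alpha[
| OneCellBounded (alpha beta : R) of
    real_algebraic alpha & real_algebraic beta &
    (0 <= alpha /\ alpha < beta) \/ (alpha < beta /\ beta <= 0) :
    one_cell `]alpha, beta[
| OneCellPinfty (alpha : R) of real_algebraic alpha & 0 <= alpha :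
    one_cell `]alpha, +oo[.

(* Main.v *)
Require Import Defs.

Set Implicit Arguments.
Unset Strict Implicit.
Unset Printing Implicit Defensive.
Import Order.TTheory GRing.Theory Num.Theory.

Local Open Scope classical_set_scope.
Local Open Scope ring_scope.

(** For a fixed real [r], the exponents [n] with [r ^+ n] rational are closed
    under gcd (Bezout), so the gcd of the [a i] is a suitable [d].  Conversely,
    [r = q * s] with [s] the positive [d]-th root of 2 and [q] a nonzero rational
    has [r ^+ n] rational exactly when [d] divides [n], and such [r] are dense;
    every 1-cell is open, nonempty and avoids 0. *)

Lemma rational_div (R : realType) (x y : R) :
  rational x -> rational y -> rational (x / y).
Proof. by move=> [p _ <-] [q _ <-]; exists (p / q) => //; rewrite fmorph_div. Qed.

Lemma rational_exp (R : realType) (x : R) n : rational x -> rational (x ^+ n).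
Proof. by move=> [p _ <-]; exists (p ^+ n) => //; rewrite rmorphXn. Qed.

Lemma rational_exp_gcdn (R : realType) (r : R) (m n : nat) :
  rational (r ^+ m) -> rational (r ^+ n) -> rational (r ^+ gcdn m n).
Proof.
move=> rat_m rat_n; have [->|m_gt0] := posnP m; first by rewrite gcd0n.
(* The quotient formula below divides by powers of [r]. For [r = 0], both [m] and the gcd are
   positive, so the two powers are 0 alike. *)
have [r0|r_neq0] := eqVneq r 0.
  move: rat_m; rewrite r0 !expr0n -[m == 0]negbK -lt0n m_gt0 eqn0Ngt.
  by rewrite gcdn_gt0 m_gt0.
(* Bezout over the naturals: [gcdn m n + u * n = v * m], hence a quotient of powers. *)
have [u _ /dvdnP[v eq_uv]] := Bezoutl n m_gt0.
have -> : r ^+ gcdn m n = (r ^+ m) ^+ v / (r ^+ n) ^+ u.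
  apply: (canRL (mulfK _)); first by rewrite !expf_neq0.
  by rewrite -!exprM -exprD (mulnC n) eq_uv mulnC.
by apply: rational_div; apply: rational_exp.
Qed.

Lemma rational_exp_biggcdn (R : realType) (r : R) k (a : 'I_k -> nat) :
  (forall i, rational (r ^+ a i)) -> rational (r ^+ \big[gcdn/0]_i a i).
Proof.
move=> rat_a; elim/big_ind: _ => //; last exact: rational_exp_gcdn.
(* The empty gcd is 0, and [r ^+ 0 = 1]. *)
by exists 1 => //; rewrite rmorph1.
Qed.

(** Intermediate value theorem for ['X^d - 2] on [0, 2]: it is negative at 0, and [2 <= 2 ^+ d]. *)
Lemma exists_root2 (R : realType) (d : nat) :
  (0 < d)%N -> exists2 s : R, 0 < s & s ^+ d = 2.
Proof.
move=> d_gt0; have [||s /andP[s_ge0 _]] := @poly_ivt R ('X^d - 2%:P) 0 2.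
- exact: ler0n.
- rewrite !hornerE expr0n eqn0Ngt d_gt0 sub0r oppr_le0 ler0n subr_ge0 /=.
  by rewrite ler_eXnr // ler1n.
rewrite rootE !hornerE subr_eq0 => /eqP sd; exists s => //.
rewrite lt_neqAle s_ge0 andbT eq_sym; apply/eqP => s0.
by move/eqP: sd; rewrite s0 expr0n eqn0Ngt d_gt0 eq_sym pnatr_eq0.
Qed.

(** If [q] is the rational value of [s ^+ n], then [q ^+ d = 2 ^+ n]. Clearing denominators and
    taking 2-adic valuations v gives d v(num) = n + d v(den). *)
Lemma dvdn_of_rational_exp_root2 (R : realType) (s : R) (d n : nat) :
  s ^+ d = 2 -> rational (s ^+ n) -> (d %| n)%N.
Proof.
move=> sd [q _ qE].
have qd : q ^+ d = 2 ^+ n.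
  by apply: (fmorph_inj (@ratr R)); rewrite !rmorphXn /= qE exprAC sd ratr_nat.
have q_neq0 : q != 0.
  have [d0|d_gt0] := posnP d.
    by move/eqP: sd; rewrite d0 expr0 eq_sym pnatr_eq1.
  apply: contra_eqN qd => /eqP ->.
  by rewrite expr0n eqn0Ngt d_gt0 eq_sym expf_neq0.
have /(congr1 absz) : numq q ^+ d = 2 ^+ n * denq q ^+ d.
  apply: (@intr_inj rat); rewrite rmorphM !rmorphXn /= -qd -exprMn.
  by rewrite -[q in q * _]divq_num_den divfK // intr_eq0 denq_eq0.
rewrite abszM !abszX => /(congr1 (logn 2)).
rewrite lognM ?expn_gt0 ?absz_gt0 ?denq_eq0 // !lognX => /(congr1 (dvdn d)).
by rewrite dvdn_mulr // dvdn_addl ?(dvdn_mulr _ (dvdnn d)) // muln1 => <-.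
Qed.

Lemma rational_exp_dense (R : realType) (d : nat) (l u : R) :
  (0 < d)%N -> l < u -> ~~ (l < 0 < u) ->
  exists2 r : R, l < r < u & forall n, rational (r ^+ n) <-> (d %| n)%N.
Proof.
move=> d_gt0 lt_lu not_l0u; have [s s_gt0 sd] := exists_root2 R d_gt0.
(* Scaling by [s > 0] carries the rationals of this interval to points [q * s] of []l, u[]. *)
have [q] : exists q, ratr q \in `]l / s, (u / s)[.
  by apply: rat_in_itvoo; rewrite ltr_pM2r ?invr_gt0.
rewrite in_itv /= ltr_pdivrMr // ltr_pdivlMr // => qs_in.
have q_neq0 : ratr q != 0 :> R.
  by apply: contraNneq not_l0u => q0; move: qs_in; rewrite q0 mul0r.
exists (ratr q * s) => // n; rewrite exprMn; split=> [rat_n|/dvdnP[k ->]].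
  apply: (dvdn_of_rational_exp_root2 sd).
  (* Dividing out the nonzero rational [q ^+ n] reduces the claim to [s]. *)
  have -> : s ^+ n = ratr q ^+ n * s ^+ n / ratr q ^+ n.
    by rewrite mulrAC divff ?mul1r // expf_neq0.
  by apply: rational_div => //; apply: rational_exp; exists q.
exists (q ^+ (k * d) * 2 ^+ k) => //.
by rewrite rmorphM !rmorphXn /= mulnC exprM [s ^+ _]exprM sd ratr_nat -exprM.
Qed.

(** An unbounded cell is cut down to the unit-length interval next to its finite endpoint. *)
Lemma one_cell_itv (R : realType) (c : set R) : one_cell c ->
  exists l u : R, [/\ l < u, ~~ (l < 0 < u) & `]l, u[ `<=` c].
Proof.
case=> [alpha _ alpha_le0|alpha beta _ _ sgn|alpha _ alpha_ge0].
- exists (alpha - 1), alpha; split; first by rewrite gtrBl ltr01.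
    by rewrite negb_and -!leNgt alpha_le0 orbT.
  by move=> x; rewrite /= !in_itv /= => /andP[].
- exists alpha, beta; split=> //; first by case: sgn => -[].
  by rewrite negb_and -!leNgt; case: sgn => -[] => [->|_ ->] //; rewrite orbT.
- exists alpha, (alpha + 1); split; first by rewrite ltrDl ltr01.
    by rewrite negb_and -!leNgt alpha_ge0.
  by move=> x; rewrite /= !in_itv /= andbT => /andP[].
Qed.

Theorem theorem3 (R : realType) (k1 k2 : nat)
    (a : 'I_k1 -> nat) (b : 'I_k2 -> nat)
    (a_gt0 : forall i, (0 < a i)%N) (b_gt0 : forall j, (0 < b j)%N)
    (c : set R) (cell_c : one_cell c) :
  (exists r : R, [/\ c r,
     forall i, rational (r ^+ a i) & forall j, ~ rational (r ^+ b j)]) <->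
  (exists d : nat, [/\ (0 < d)%N,
     forall i, (d %| a i)%N & forall j, ~~ (d %| b j)%N]).
Proof.
split=> [[r [_ rat_a irrat_b]]|[d [d_gt0 dvd_a ndvd_b]]].
  pose g := (\big[gcdn/0]_i a i)%N.
  have rat_g : rational (r ^+ g) by exact: rational_exp_biggcdn.
  have dvd_g i : (g %| a i)%N by exact: (biggcdn_inf i).
  have [g0|g_gt0] := posnP g.
    (* Only possible when there are no [a i]: any [d] exceeding all [b j] works. *)
    exists (\sum_j b j).+1%N; split=> // [i|j].
      by move: (dvd_g i) (a_gt0 i); rewrite g0 dvd0n => /eqP ->.
    by rewrite gtnNdvd // ltnS (bigD1 j) //= leq_addr.
  (* If [g] divided [b j], then [r ^+ b j] would be a power of the rational [r ^+ g]. *)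
  exists g; split=> // j; apply/negP => /dvdnP[k bE]; apply: (irrat_b j).
  by rewrite bE mulnC exprM; apply: rational_exp.
have [l [u [lt_lu not_l0u sub_c]]] := one_cell_itv cell_c.
have [r r_in ratE] := rational_exp_dense d_gt0 lt_lu not_l0u.
exists r; split=> [|i|j]; first by apply: sub_c; rewrite /= in_itv.
  exact/ratE.
by move/ratE; apply/negP.
Qed.
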